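(* For Minimum Spanning Forest in the standard model, the competitive ratio is $W$, where $W$ is the ratio between the largest and the smallest edge weight in the input graph. That is: (i) there is an online algorithm $\mathrm{ALG}$ in the standard model such that $\mathrm{ALG}(\sigma)\le W\cdot\mathrm{OPT}(\sigma)$ for every input $\sigma$ with weight ratio $W$; and (ii) for every fixed real $W\ge 1$ and every real $c<W$, there are no online algorithm $\mathrm{ALG}$ in the standard model and constant $\alpha$ such that $\mathrm{ALG}(\sigma)\le c\,\mathrm{OPT}(\sigma)+\alpha$ for all inputs $\sigma$ with weight ratio $W$.
   Context: Online Minimum Spanning Forest (edge arrival). An input $\sigma$ is a finite simple undirected graph $G=(V,E)$ with a weight function $w\colon E\to\mathbb{R}^+$ and an ordering of its edges. Edges arrive one by one in this order with their weights; endpoints not seen before are revealed with the edge. The weight ratio of $\sigma$ is $W=\max_{e\in E}w(e)/\min_{e\in E}w(e)$. All online algorithms are deterministic: each decision depends only on the part of the input revealed so far. After each arrival has been processed, the set of currently accepted edges must be a spanning forest of the graph revealed so far, i.e., it must form a spanning tree on each connected component of that graph. $\mathrm{ALG}(\sigma)$ is the total weight of the accepted edges at the end of the input, and $\mathrm{OPT}(\sigma)$ is the minimum total weight of a spanning forest of $G$; the objective is minimization. Standard model: upon arrival of an edge, the algorithm must immediately and irrevocably either accept or reject it. *)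

(* Defs.v *)
From HB Require Import structures.
From mathcomp Require Import all_boot all_order all_algebra finmap.
From mathcomp Require Import boolp classical_sets reals.

Set Implicit Arguments.
Unset Strict Implicit.
Unset Printing Implicit Defensive.

Import Order.TTheory GRing.Theory Num.Theory.
Local Open Scope fset_scope.
Local Open Scope classical_set_scope.
Local Open Scope ring_scope.

(* Vertices are labelled by natural numbers; an arriving edge is the unordered
   pair of its endpoints together with its weight. *)
Definition arrival (R : realType) : Type := ({fset nat} * R)%type.

(* Inputs, listed in order of arrival.  The vertex set is the union of the
   edges: isolated vertices are never revealed and affect no cost. *)
Definition is_input (R : realType) (s : seq (arrival R)) : Prop :=
  [/\ forall a, a \in s -> #|` a.1| = 2%N,
      uniq [seq a.1 | a <- s]
    & forall a, a \in s -> 0 < a.2].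

Definition max_weight (R : realType) (s : seq (arrival R)) : R :=
  \big[Num.max/0]_(a <- s) a.2.

Definition min_weight (R : realType) (s : seq (arrival R)) : R :=
  \big[Num.min/max_weight s]_(a <- s) a.2.

(* The weight ratio is only defined for graphs with at least one edge. *)
Definition input_with_ratio (R : realType) (W : R) (s : seq (arrival R)) :
    Prop :=
  [/\ is_input s, s != [::] & max_weight s / min_weight s = W].

Definition adj (R : realType) (F : seq (arrival R)) : rel nat :=
  fun x y => [fset x; y] \in [seq a.1 | a <- F].

Definition vertices (R : realType) (E : seq (arrival R)) : set nat :=
  [set u | exists2 a, a \in E & u \in a.1].

Definition component (R : realType) (E : seq (arrival R)) (u : nat) : set nat :=
  [set v | exists2 p, path (adj E) u p & last u p = v].

(* The edges of F lying inside C form a tree with vertex set C; a cycle is a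
   closed walk through at least three pairwise distinct vertices. *)
Definition spanning_tree_on (R : realType) (C : set nat)
    (F : seq (arrival R)) : Prop :=
  (forall x y, C x -> C y ->
     exists p, [/\ path (adj F) x p, last x p = y & [set` p] `<=` C])
  /\ (forall c : seq nat, [set` c] `<=` C -> (2 < size c)%N -> uniq c ->
        ~~ cycle (adj F) c).

(* The edges of E being pairwise distinct, subsets of E are encoded as
   subsequences. *)
Definition spanning_forest (R : realType) (E F : seq (arrival R)) : Prop :=
  subseq F E /\
  forall u, vertices E u -> spanning_tree_on (component E u) F.

Definition total_weight (R : realType) (F : seq (arrival R)) : R :=
  \sum_(a <- F) a.2.

(* Infimum over a finite nonempty set, hence a minimum. *)
Definition OPT (R : realType) (s : seq (arrival R)) : R :=
  inf [set total_weight F | F in [set F | spanning_forest s F]].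

(* A decision rule: [A past a] says whether the edge a, arriving after the
   arrivals [past], is accepted.  Earlier decisions need not be arguments,
   since A is deterministic. *)
Definition rule (R : realType) : Type := seq (arrival R) -> arrival R -> bool.

Fixpoint accepted_from (R : realType) (A : rule R)
    (past s : seq (arrival R)) : seq (arrival R) :=
  if s is a :: s' then
    let later := accepted_from A (rcons past a) s' in
    if A past a then a :: later else later
  else [::].

Definition accepted (R : realType) (A : rule R) (s : seq (arrival R)) :
    seq (arrival R) :=
  accepted_from A [::] s.

Definition online_algorithm (R : realType) (A : rule R) : Prop :=
  forall s, is_input s -> forall i, (i <= size s)%N ->
    spanning_forest (take i s) (accepted A (take i s)).

Definition cost (R : realType) (A : rule R) (s : seq (arrival R)) : R :=
  total_weight (accepted A s).

(* Main.v *)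
(* Greedy accepts an edge iff its endpoints are not yet connected.  Over F_2,
   send an edge to the sum of the unit vectors of its endpoints: the accepted
   edges form a free family, and any spanning forest spans their vectors, so
   greedy accepts no more edges than an optimal forest contains; each edge costs
   at most W times any other.

   For the lower bound, the edges of a star with n+1 leaves and weight W must all
   be accepted.  They are followed by a path of weight 1 through the leaves, which
   together with a single edge of the star is a spanning tree of weight W + n. *)
Require Import Defs.
From mathcomp Require Import all_boot all_order all_algebra.
From mathcomp Require Import finmap boolp classical_sets reals.
From mathcomp Require Import zify lra.

Import Order.TTheory GRing.Theory Num.Theory.
Local Open Scope fset_scope.
Local Open Scope ring_scope.

Set Implicit Arguments.
Unset Strict Implicit.

(** * Unordered pairs of vertices *)

Lemma card2_fsetP (e : {fset nat}) :
  #|` e| = 2 -> exists x y, x != y /\ e = [fset x; y].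
Proof.
move=> e2; have [x xe] : exists x, x \in e.
  by apply/fset0Pn; rewrite -cardfs_gt0 e2.
move: e2; rewrite (cardfsD1 x) xe => -[/eqP/cardfs1P[y ey]]; exists x, y; split.
  by have := fset11 y; rewrite -ey !inE eq_sym => /andP[].
by rewrite -ey fsetD1K.
Qed.

Lemma fset2C (x y : nat) : [fset x; y] = [fset y; x].
Proof. exact: fsetUC. Qed.

Lemma fset2_eq (x y u v : nat) : [fset x; y] = [fset u; v] ->
  (x = u /\ y = v) \/ (x = v /\ y = u).
Proof.
move=> /fsetP E.
have := E x; have := E y; have := E u; have := E v.
rewrite !inE !eqxx ?orbT /=.
by do ![case: eqP => ? //=]; subst; tauto.
Qed.

(** * Walks, components and acyclic edge sets *)

Section Graph.
Context {R : realType}.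
Implicit Types (E F s : seq (arrival R)) (a : arrival R) (x y z : nat).

(** This is the cycle clause of [spanning_tree_on] freed from the vertex set, so that it serves all
    components at once. *)
Definition acyclic F := forall c : seq nat,
  (2 < size c)%N -> uniq c -> ~~ cycle (adj F) c.

Lemma adjC F x y : adj F x y = adj F y x.
Proof. by rewrite /adj fset2C. Qed.

Lemma adjP F x y : reflect (exists2 a, a \in F & a.1 = [fset x; y]) (adj F x y).
Proof.
apply: (iffP mapP) => -[a aF e]; exists a => //; exact: esym.
Qed.

Lemma adj_sub F E x y : {subset F <= E} -> adj F x y -> adj E x y.
Proof. by move=> FE /adjP[a /FE aE e]; apply/adjP; exists a. Qed.

Lemma component_refl F x : component F x x.
Proof. by exists [::]. Qed.

Lemma component_trans F y x z :
  component F x y -> component F y z -> component F x z.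
Proof.
move=> [p pp <-] [q qq <-]; exists (p ++ q); last by rewrite last_cat.
by rewrite cat_path pp.
Qed.

Lemma component_adj F x y : adj F x y -> component F x y.
Proof. by move=> xy; exists [:: y]; rewrite /= ?xy. Qed.

Lemma component_sym F x y : component F x y -> component F y x.
Proof.
move=> [p]; elim: p x => [|z p IH] x /=.
  by move=> _ ->; exact: component_refl.
move=> /andP[xz zp] l; apply: (component_trans (IH _ zp l)).
by apply: component_adj; rewrite adjC.
Qed.

Lemma component_mono F E x y :
  (forall u v, adj F u v -> component E u v) ->
  component F x y -> component E x y.
Proof.
move=> FE [p]; elim: p x => [|z p IH] x /=.
  by move=> _ ->; exact: component_refl.
by move=> /andP[/FE xz zp] l; apply: component_trans xz (IH _ zp l).
Qed.

Lemma component_isolated F x y :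
  (forall a, a \in F -> y \notin a.1) -> component F x y -> x = y.
Proof.
move=> yF [p]; case/lastP: p => [|p z] //.
rewrite last_rcons rcons_path => /andP[_ /adjP[a aF e]] zy; subst z.
by move: (yF _ aF); rewrite e !inE eqxx orbT.
Qed.

Lemma acyclic_nil : acyclic [::].
Proof. by case=> [|x [|y c]]. Qed.

(** A new cycle would have to use [a]; the rest of it would be a walk in [F] joining the endpoints
    of [a]. *)
Lemma acyclic_rcons F a :
  acyclic F -> (forall x y, a.1 = [fset x; y] -> ~ component F x y) ->
  acyclic (rcons F a).
Proof.
move=> acF sep c c2 cU; apply/negP => cC.
have adjE u v : adj (rcons F a) u v -> ~ adj F u v -> a.1 = [fset u; v].
  move=> /adjP[b]; rewrite mem_rcons inE => /orP[/eqP -> //|bF] e [].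
  by apply/adjP; exists b.
(* Otherwise [c] would already be a cycle in [F]. *)
have [x xc nx] : exists2 x, x \in c & ~ adj F x (next c x).
  apply: contrapT => H; move/negP: (acF _ c2 cU); apply.
  apply: cycle_from_next => // x xc; apply: contrapT => nx; apply: H.
  by exists x.
have e : a.1 = [fset x; next c x] by apply: adjE (next_cycle cC xc) nx.
(* Rotate the cycle so that it starts with the new edge, traversed from [x] to [y]. *)
case: (rot_to xc) => i c' rc.
move: e; rewrite -(next_rot i cU) rc => {nx}.
have: (2 < size (rot i c))%N by rewrite size_rot.
have: uniq (rot i c) by rewrite rot_uniq.
have: cycle (adj (rcons F a)) (rot i c) by rewrite rot_cycle.
rewrite {}rc; case: c' => [|y [|z d]] //=.
rewrite eqxx => /andP[_ /andP[yz zd]] /andP[xN /andP[yN _]] _ e.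
apply: (sep y x); first by rewrite e fset2C.
have step u v : u != y -> v != y -> adj (rcons F a) u v -> adj F u v.
  move=> uy vy uv; apply: contrapT => /(adjE _ _ uv); rewrite e => /fsetP/(_ y).
  by rewrite !inE eqxx orbT eq_sym (negbTE uy) eq_sym (negbTE vy).
exists (z :: rcons d x); last by rewrite /= last_rcons.
move: xN yN; rewrite !inE !negb_or => /and3P[xy xz xd] /andP[ney yd].
(* The step from [y] to [z] touches [y], so [step] does not cover it. It is not [a] because [x]
   differs from both [y] and [z], the cycle having at least three vertices. *)
apply/andP; split.
  apply: contrapT => /(adjE _ _ yz); rewrite e => /fsetP/(_ x).
  by rewrite !inE eqxx (negbTE xy) (negbTE xz).
apply: (sub_in_path (P := predC1 y) _ _ zd).
  by move=> u v; rewrite !inE; exact: step.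
rewrite /= eq_sym ney all_rcons /= xy /=.
by apply/allP => u ud /=; apply: contraNneq yd => <-.
Qed.

Lemma spanning_forestI E F : subseq F E -> acyclic F ->
  (forall x y, adj E x y -> component F x y) -> spanning_forest E F.
Proof.
move=> FE acF con; split=> // u _; split; last by move=> c _; exact: acF.
move=> x y ux uy.
have [p xp l] : component F x y.
  exact: component_mono con (component_trans (component_sym ux) uy).
(* A prefix of the walk, read in [E], shows that each of its vertices stays in the component. *)
exists p; split=> // v /= vp; apply: (component_trans ux).
have {}vp : v \in x :: p by rewrite inE vp orbT.
case/splitPl: vp xp {l} => p1 p2 l; rewrite cat_path => /andP[xp1 _].
exists p1 => //; apply: sub_path xp1 => i j; apply: adj_sub.
exact: mem_subseq FE.
Qed.

Lemma spanning_forest_connects E F x y :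
  spanning_forest E F -> adj E x y -> component F x y.
Proof.
move=> [_ sp] xy; have [a aE e] := adjP _ _ _ xy.
have [|con _] := sp x; first by exists a => //; rewrite e !inE eqxx.
have [p [xp l _]] := con x y (component_refl _ _) (component_adj xy).
by exists p.
Qed.

(** * Edges as vectors over the field with two elements *)

Section CutSpace.
Variable N : nat.

Definition vertex_vec (x : nat) : 'rV['F_2]_N := \row_i (x == i)%:R.
Definition edge_vec (e : {fset nat}) : 'rV['F_2]_N := \row_i ((i : nat) \in e)%:R.
Definition edge_vecs F := [seq edge_vec a.1 | a <- F].

Lemma vertex_vecDD x : vertex_vec x + vertex_vec x = 0.
Proof. by apply/rowP => i; rewrite !mxE; case: (_ == _); apply/eqP. Qed.

Lemma edge_vec2 x y : x != y ->
  edge_vec [fset x; y] = vertex_vec x + vertex_vec y.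
Proof.
move=> xy; apply/rowP => i; rewrite !mxE !inE.
rewrite !(eq_sym (i : nat)).
case: eqP => [<-|_] /=; last by rewrite add0r.
  by rewrite [y == x]eq_sym (negbTE xy) addr0.
Qed.

(** Summing the edges of a walk telescopes: modulo 2 the inner vertices cancel. *)
Lemma component_span F x y : component F x y ->
  vertex_vec x + vertex_vec y \in <<edge_vecs F>>%VS.
Proof.
move=> [p]; elim: p x => [|z p IH] x /=.
  by move=> _ ->; rewrite vertex_vecDD mem0v.
move=> /andP[/adjP[a aF e] zp] l.
have -> : vertex_vec x + vertex_vec y =
   (vertex_vec x + vertex_vec z) + (vertex_vec z + vertex_vec y).
  by rewrite addrA -(addrA (vertex_vec x)) vertex_vecDD addr0.
(* [adj] holds at [x = z] if [F] contains a singleton; such a step contributes zero. *)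
apply: memvD (IH _ zp l); have [<-|xz] := eqVneq x z.
  by rewrite vertex_vecDD mem0v.
by rewrite -edge_vec2 // -e; apply/memv_span/map_f.
Qed.

Lemma edge_vec_notin_span F x y :
  (forall a, a \in F -> #|` a.1| = 2) ->
  (forall a v, a \in F -> v \in a.1 -> (v < N)%N) ->
  (x < N)%N -> x != y -> ~ component F x y ->
  edge_vec [fset x; y] \notin <<edge_vecs F>>%VS.
Proof.
move=> F2 FN xN xy nxy.
(* The indicator of the component of x is orthogonal to every edge of F. *)
pose C : 'cV['F_2]_N := \col_i (`[< component F x i >])%:R.
have fE v : (v < N)%N -> vertex_vec v *m C = (`[< component F x v >])%:R%:M.
  move=> vN; apply/matrixP => i j; rewrite !ord1 !mxE eqxx mulr1n.
  rewrite (bigD1 (Ordinal vN)) //= big1 => [|k kv].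
    by rewrite !mxE eqxx mul1r addr0.
  rewrite !mxE; case: eqP => [vk|]; last by rewrite mul0r.
  by case/eqP: kv; apply: val_inj.
(* This also covers labels beyond [N], whose vectors vanish; it is applied to [y]. *)
have fE0 v : ~ component F x v -> vertex_vec v *m C = 0.
  move=> nv; apply/matrixP => i j; rewrite !mxE big1 // => k _; rewrite !mxE.
  case: eqP => [vk|]; last by rewrite mul0r.
  by rewrite -vk asboolF // mulr0.
pose f := linfun (mulmxr C : 'rV['F_2]_N -> 'M['F_2]_1).
have sub : (<<edge_vecs F>> <= lker f)%VS.
  apply/span_subvP => _ /mapP[a aF ->]; rewrite memv_ker lfunE /=.
  have [u [v [uv e]]] := card2_fsetP (F2 _ aF).
  have auv : adj F u v by apply/adjP; exists a.
  rewrite e edge_vec2 // mulmxDl !fE; last 2 first.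
  - by apply: (FN a) => //; rewrite e !inE eqxx orbT.
  - by apply: (FN a) => //; rewrite e !inE eqxx.
  (* Both endpoints of an edge of [F] lie on the same side of the cut, so their values are equal and
     sum to zero modulo 2. *)
  have -> : `[< component F x u >] = `[< component F x v >].
    apply: asbool_equiv_eq; split=> h; apply: (component_trans h).
      exact: component_adj.
    by apply: component_adj; rewrite adjC.
  by apply/eqP/matrixP => i j; rewrite !mxE !ord1; case: asbool; apply/eqP.
apply/negP => /(subvP sub); rewrite memv_ker lfunE /= edge_vec2 // mulmxDl.
rewrite fE // (fE0 y) // addr0 asboolT; last exact: component_refl.
by move=> /eqP/matrixP/(_ ord0 ord0); rewrite !mxE => /eqP.
Qed.

End CutSpace.

(** Supplies a finite dimension for the vector space, vertex labels being arbitrary naturals. *)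
Lemma vertices_bounded s :
  exists N, forall a v, a \in s -> v \in a.1 -> (v < N)%N.
Proof.
exists (\max_(v <- flatten [seq enum_fset b.1 | b <- s]) v).+1 => a v aS va.
rewrite ltnS; apply: (@leq_bigmax_seq _ _ xpredT id) => //.
apply/flattenP; exists (enum_fset a.1) => //.
exact: (map_f (fun b : arrival R => enum_fset b.1)).
Qed.

(** * Runs of a rule, and the greedy algorithm *)

Lemma accepted_from_cat (A : rule R) past s1 s2 :
  accepted_from A past (s1 ++ s2) =
  accepted_from A past s1 ++ accepted_from A (past ++ s1) s2.
Proof.
elim: s1 past => [|a s1 IH] past /=; first by rewrite cats0.
by rewrite IH cat_rcons; case: ifP.
Qed.

Lemma accepted_rcons (A : rule R) s a :
  accepted A (rcons s a) =
  if A s a then rcons (accepted A s) a else accepted A s.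
Proof.
rewrite /accepted -cats1 accepted_from_cat /=.
by case: ifP; rewrite ?cats0 ?cats1.
Qed.

Lemma accepted_from_subseq (A : rule R) past s :
  subseq (accepted_from A past s) s.
Proof.
elim: s past => //= a s IH past; case: ifP => _; first by rewrite /= eqxx.
exact: subseq_trans (IH _) (subseq_cons _ _).
Qed.

Lemma accepted_sub (A : rule R) s : {subset accepted A s <= s}.
Proof. exact/mem_subseq/accepted_from_subseq. Qed.

Lemma is_input_subseq s1 s2 : subseq s1 s2 -> is_input s2 -> is_input s1.
Proof.
move=> s12 [c2 u2 w2]; split.
- by move=> a /(mem_subseq s12); exact: c2.
- exact: subseq_uniq (map_subseq _ s12) u2.
- by move=> a /(mem_subseq s12); exact: w2.
Qed.

Lemma is_input_rcons s a : is_input (rcons s a) -> is_input s.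
Proof. by apply: is_input_subseq; exact: subseq_rcons. Qed.

(** Connectivity is tested in all revealed edges, since a rule sees only [past]; by
    [greedy_connects] the accepted edges have the same components. *)
Definition greedy : rule R := fun past a =>
  `[< forall x y, a.1 = [fset x; y] -> ~ component past x y >].

Lemma greedy_separates s a x y :
  greedy s a -> a.1 = [fset x; y] -> ~ component (accepted greedy s) x y.
Proof.
move=> /asboolP sep /sep nxy h; apply: nxy; apply: component_mono h => u v uv.
exact/component_adj/(adj_sub (@accepted_sub _ _))/uv.
Qed.

Lemma greedy_acyclic s : acyclic (accepted greedy s).
Proof.
elim/last_ind: s => [|s a IH]; first exact: acyclic_nil.
rewrite accepted_rcons; case: ifP => // ga.
by apply: acyclic_rcons => // x y; exact: greedy_separates.
Qed.

Lemma greedy_connects s x y : adj s x y -> component (accepted greedy s) x y.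
Proof.
elim/last_ind: s x y => [|s a IH] x y // xy.
have mono u v : component (accepted greedy s) u v ->
    component (accepted greedy (rcons s a)) u v.
  apply: component_mono => i j ij; apply: component_adj.
  apply: adj_sub ij => b; rewrite accepted_rcons; case: ifP => // _.
  by rewrite mem_rcons inE => ->; rewrite orbT.
move: xy => /adjP[b]; rewrite mem_rcons inE => /orP[/eqP -> {b}|bs] e; last first.
  by apply/mono/IH/adjP; exists b.
case ga : (greedy s a).
  apply/component_adj/adjP; exists a => //.
  by rewrite accepted_rcons ga mem_rcons mem_head.
(* If the endpoints of a rejected edge were not joined by accepted edges, they would not be
   connected in [s] either, and greedy would have accepted it. *)
apply: contrapT => nxy; move/asboolPn: (negbT ga); apply => u v.
have nc : ~ component s x y.
  by move=> h; apply/nxy/mono; apply: component_mono h; exact: IH.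
rewrite e => /fset2_eq[[<- <-] //|[<- <-]] /component_sym; exact: nc.
Qed.

Lemma greedy_spanning s : spanning_forest s (accepted greedy s).
Proof.
apply: spanning_forestI; [exact: accepted_from_subseq|exact: greedy_acyclic|].
exact: greedy_connects.
Qed.

(** An accepted edge joins two components of the earlier accepted edges, so its vector lies outside
    their span. *)
Lemma greedy_free N s : is_input s ->
  (forall a v, a \in s -> v \in a.1 -> (v < N)%N) ->
  free (edge_vecs N (accepted greedy s)).
Proof.
elim/last_ind: s => [|s a IH] Is sN; first exact: nil_free.
have sub : {subset s <= rcons s a}.
  by move=> b bs; rewrite mem_rcons inE bs orbT.
have /IH{}IH := is_input_rcons Is.
have {}IH : free (edge_vecs N (accepted greedy s)).
  by apply: IH => b v /sub; exact: sN.
rewrite accepted_rcons; case: ifP => // ga.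
rewrite /edge_vecs map_rcons (perm_free (permEl (perm_rcons _ _))) free_cons.
rewrite IH andbT; case: Is => c2 _ _.
have aS : a \in rcons s a by rewrite mem_rcons mem_head.
have [x [y [xy e]]] := card2_fsetP (c2 _ aS).
rewrite e; apply: edge_vec_notin_span => //.
- by move=> b /accepted_sub/sub; exact: c2.
- by move=> b v /accepted_sub/sub; exact: sN.
- by apply: (sN a) => //; rewrite e !inE eqxx.
- exact: greedy_separates ga e.
Qed.

(** The size of the free greedy family is the dimension of its span, which lies in the span of the
    vectors of [F], of dimension at most [size F]. *)
Lemma greedy_size_min s F : is_input s -> spanning_forest s F ->
  (size (accepted greedy s) <= size F)%N.
Proof.
move=> Is sF; have [N sN] := vertices_bounded s.
have := greedy_free Is sN; rewrite /free => /eqP.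
rewrite size_map => <-.
rewrite -(size_map (fun a => edge_vec N a.1) F).
apply: leq_trans (dim_span _); apply/dimvS/span_subvP => _ /mapP[a aF ->].
have aS := accepted_sub aF; case: (Is) => c2 _ _.
have [x [y [xy e]]] := card2_fsetP (c2 _ aS).
rewrite e edge_vec2 //; apply: component_span.
by apply: spanning_forest_connects sF _; apply/adjP; exists a.
Qed.

(** * Weight estimates and the upper bound *)

Lemma le_max_weight s a : a \in s -> a.2 <= max_weight s.
Proof. by move=> aS; exact: Order.TotalTheory.le_bigmax_seq. Qed.

Lemma min_weight_le s a : a \in s -> min_weight s <= a.2.
Proof. by move=> aS; exact: ge_bigmin_seq. Qed.

Lemma min_weight_gt0 s : is_input s -> s != [::] -> 0 < min_weight s.
Proof.
move=> [_ _ w0]; case: s w0 => // a s w0 _.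
rewrite /min_weight big_seq; apply: lt_bigmin; last by move=> b bs; exact: w0.
(* The default value of the minimum, [max_weight s], must be positive too. *)
by apply: lt_le_trans (le_max_weight (mem_head a s)); apply/w0/mem_head.
Qed.

Lemma sum_const_seq (T : Type) (r : seq T) (c : R) :
  \sum_(i <- r) c = c * (size r)%:R.
Proof. by rewrite big_const_seq count_predT iter_addr_0 mulr_natr. Qed.

Lemma total_weight_le_max s F : {subset F <= s} ->
  total_weight F <= max_weight s * (size F)%:R.
Proof.
move=> Fs; rewrite /total_weight -sum_const_seq big_seq [leRHS]big_seq.
by apply: ler_sum => a /Fs; exact: le_max_weight.
Qed.

Lemma min_le_total_weight s F : {subset F <= s} ->
  min_weight s * (size F)%:R <= total_weight F.
Proof.
move=> Fs; rewrite /total_weight -sum_const_seq big_seq [leRHS]big_seq.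
by apply: ler_sum => a /Fs; exact: min_weight_le.
Qed.

Lemma total_weight_ge0 s F : is_input s -> {subset F <= s} -> 0 <= total_weight F.
Proof.
move=> [_ _ w0] Fs; rewrite /total_weight big_seq; apply: sumr_ge0 => a /Fs as_.
exact/ltW/w0.
Qed.

Lemma OPT_ge0 s : is_input s -> 0 <= OPT s.
Proof.
move=> Is; apply: lb_le_inf.
  exists (total_weight (accepted greedy s)), (accepted greedy s) => //.
  exact: greedy_spanning.
by move=> _ [F [Fs _] <-]; apply: total_weight_ge0 Is (mem_subseq Fs).
Qed.

Lemma OPT_le s F : is_input s -> spanning_forest s F -> OPT s <= total_weight F.
Proof.
move=> Is sF; apply: ge_inf; last by exists F.
by exists 0 => _ [G [Gs _] <-]; apply: total_weight_ge0 Is (mem_subseq Gs).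
Qed.

Lemma greedy_cost W s : input_with_ratio W s -> cost greedy s <= W * OPT s.
Proof.
move=> [Is s0 ratio]; have m0 := min_weight_gt0 Is s0.
have M0 : 0 < max_weight s.
  case: s Is s0 {ratio m0} => // a s [_ _ w0] _.
  by apply: lt_le_trans (le_max_weight (mem_head a s)); apply/w0/mem_head.
have W0 : 0 < W by rewrite -ratio divr_gt0.
(* Dividing by [W] turns the claim into a lower bound on an infimum, checked on each spanning forest
   [F] separately. *)
rewrite mulrC -ler_pdivrMr //; apply: lb_le_inf.
  exists (total_weight (accepted greedy s)), (accepted greedy s) => //.
  exact: greedy_spanning.
move=> _ [F sF <-]; rewrite ler_pdivrMr //.
apply: le_trans (total_weight_le_max (@accepted_sub _ _)) _.
apply: (@le_trans _ _ (max_weight s * (size F)%:R)).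
  by rewrite ler_pM2l // ler_nat; exact: greedy_size_min.
have -> : max_weight s = min_weight s * W by rewrite -ratio mulrC divfK ?gt_eqF.
rewrite mulrAC ler_pM2r //; apply: min_le_total_weight.
exact/mem_subseq/(proj1 sF).
Qed.

(** * The input for the lower bound *)

Section WheelInput.
Variable W : R.

Definition star n : seq (arrival R) := mkseq (fun i => ([fset 0%N; i.+1], W)) n.
Definition rim n : seq (arrival R) :=
  mkseq (fun i => ([fset i.+1; i.+2], 1)) n.
(** The graph is a fan: hub 0, leaves 1 to n+1, and a rim that is not closed up. *)
Definition wheel n := star n.+1 ++ rim n.
Definition rim_tree n := ([fset 0%N; 1%N], W) :: rim n.

Lemma starP n a : reflect (exists2 i, (i < n)%N & a = ([fset 0%N; i.+1], W))
  (a \in star n).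
Proof.
apply: (iffP idP) => [/mapP[i]|[i ltin ->]].
  by rewrite mem_iota => ltin ->; exists i.
by apply/mapP; exists i; rewrite ?mem_iota.
Qed.

Lemma rimP n a : reflect (exists2 i, (i < n)%N & a = ([fset i.+1; i.+2], 1))
  (a \in rim n).
Proof.
apply: (iffP idP) => [/mapP[i]|[i ltin ->]].
  by rewrite mem_iota => ltin ->; exists i.
by apply/mapP; exists i; rewrite ?mem_iota.
Qed.

Lemma wheel_input n : 1 <= W -> is_input (wheel n).
Proof.
move=> W1; split.
- move=> a; rewrite mem_cat => /orP[/starP|/rimP] [i _ ->] /=; rewrite cardfs2 //.
  by rewrite neq_ltn ltnSn.
- rewrite map_cat cat_uniq /star /rim /mkseq -!map_comp.
  rewrite !map_inj_uniq ?iota_uniq ?andbT.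
  + apply/hasPn => _ /mapP[i _ ->]. apply/negP => /mapP[j _ /= e].
    by case: (fset2_eq e) => -[].
  + by move=> i j /= e; case: (fset2_eq e) => -[]; [move=> [] | move=> -> []; lia].
  + by move=> i j /= e; case: (fset2_eq e) => -[] // _ [].
- move=> a; rewrite mem_cat => /orP[/starP|/rimP] [i _ ->] //=.
  exact: lt_le_trans W1.
Qed.

(** The index [n.+1] ensures a rim edge, so that the weight 1 occurs. *)
Lemma wheel_ratio n : 1 <= W -> input_with_ratio W (wheel n.+1).
Proof.
move=> W1; split=> //; first exact: wheel_input.
have W0 : 0 <= W by apply: le_trans W1.
have wt a : a \in wheel n.+1 -> 1 <= a.2 <= W.
  by rewrite mem_cat => /orP[/starP|/rimP] [i _ ->] /=; rewrite ?lexx ?W1.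
have sW : ([fset 0%N; 1%N], W) \in wheel n.+1.
  by rewrite mem_cat; apply/orP; left; apply/starP; exists 0%N.
have r1 : ([fset 1%N; 2%N], 1) \in wheel n.+1.
  by rewrite mem_cat; apply/orP; right; apply/rimP; exists 0%N.
have -> : max_weight (wheel n.+1) = W.
  apply/le_anti; rewrite (le_max_weight sW) andbT /max_weight big_seq.
  by apply: bigmax_le => // a /wt /andP[].
suff -> : min_weight (wheel n.+1) = 1 by rewrite divr1.
apply/le_anti; rewrite (min_weight_le r1) /= /min_weight big_seq.
apply: le_bigmin => [|a /wt /andP[] //].
exact: le_trans W1 (le_max_weight sW).
Qed.

(** Each rim edge attaches a fresh leaf at the end of the path built so far. *)
Lemma rim_tree_acyclic n : acyclic (rim_tree n).
Proof.
have base : acyclic [:: ([fset 0%N; 1%N], W)].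
  apply: (acyclic_rcons (F := [::])) => [|x y /= e]; first exact: acyclic_nil.
  move=> /component_isolated h; have {h} xy : x = y by apply: h.
  by case: (fset2_eq e) => -[]; rewrite xy => <-.
elim: n => // n IH.
have -> : rim_tree n.+1 = rcons (rim_tree n) ([fset n.+1; n.+2], 1).
  by rewrite /rim_tree /rim mkseqS.
apply: acyclic_rcons IH _ => x y /= e.
have iso a : a \in rim_tree n -> n.+2 \notin a.1.
  rewrite inE => /orP[/eqP ->|/rimP [i ltin ->]]; rewrite !inE //=; lia.
case: (fset2_eq e) => -[<- <-]; last move/component_sym.
  by move=> /(component_isolated iso); lia.
by move=> /(component_isolated iso); lia.
Qed.

Lemma rim_tree_spanning n : spanning_forest (wheel n) (rim_tree n).
Proof.
apply: spanning_forestI; last 1 first.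
- have con k : (k <= n.+1)%N -> component (rim_tree n) 0%N k.
    elim: k => [|[|k] IH] kn; first exact: component_refl.
      by apply/component_adj/adjP; exists ([fset 0%N; 1%N], W); rewrite ?mem_head.
    apply: (component_trans (IH (ltnW kn))); apply/component_adj/adjP.
    exists ([fset k.+1; k.+2], 1) => //.
    by rewrite inE; apply/orP; right; apply/rimP; exists k.
  move=> x y /adjP[a aw e].
  suff vn v : v \in a.1 -> (v <= n.+1)%N.
    apply: (component_trans (component_sym (con _ (vn x _)))); last apply/con/vn.
      by rewrite e !inE eqxx.
    by rewrite e !inE eqxx orbT.
  move: aw; rewrite mem_cat => /orP[/starP|/rimP] [i ltin ->] /=;
  by rewrite !inE => /orP[] /eqP ->; lia.
- rewrite /wheel /star /mkseq /= eqxx.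
  exact: suffix_subseq.
- exact: rim_tree_acyclic.
Qed.

Lemma OPT_wheel_le n : 1 <= W -> OPT (wheel n) <= W + n%:R.
Proof.
move=> W1; apply: le_trans (OPT_le (wheel_input n W1) (rim_tree_spanning n)) _.
rewrite /total_weight big_cons lerD2l /rim /mkseq big_map.
by rewrite sum_const_seq size_iota mul1r.
Qed.

(** Each spoke reveals a new leaf, which would stay isolated if the spoke were rejected. *)
Lemma star_forced (A : rule R) n : 1 <= W -> online_algorithm A ->
  accepted A (star n.+1) = star n.+1.
Proof.
move=> W1 onA.
suff H m : (m <= n.+1)%N -> accepted A (star m) = star m by exact: H.
elim: m => [//|m IH] mn.
have sm : star m.+1 = rcons (star m) ([fset 0%N; m.+1], W).
  by rewrite /star mkseqS.
have Is : is_input (star m.+1).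
  by apply: is_input_subseq (wheel_input m W1); exact: prefix_subseq.
have := onA _ Is _ (leqnn _); rewrite take_size => sp.
have := spanning_forest_connects (x := 0%N) (y := m.+1) sp.
rewrite sm accepted_rcons IH ?(ltnW mn) //; case: ifP => // _ h.
have /h/component_isolated : adj (rcons (star m) ([fset 0%N; m.+1], W)) 0%N m.+1.
  by apply/adjP; exists ([fset 0%N; m.+1], W) => //; rewrite mem_rcons mem_head.
have iso a : a \in star m -> m.+1 \notin a.1.
  by move=> /starP[i im ->]; rewrite !inE; lia.
by move=> /(_ iso).
Qed.

Lemma cost_wheel_ge (A : rule R) n : 1 <= W -> online_algorithm A ->
  W * n.+1%:R <= cost A (wheel n).
Proof.
move=> W1 onA; rewrite /cost /accepted accepted_from_cat.
rewrite -/(accepted A _) star_forced //.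
rewrite /total_weight big_cat /= -[leLHS]addr0; apply: lerD.
  rewrite /star /mkseq big_map.
  by rewrite sum_const_seq size_iota.
have [_ _ w0] := wheel_input n W1; rewrite big_seq; apply: sumr_ge0 => a ain.
apply/ltW/w0; rewrite mem_cat; apply/orP; right.
exact: (mem_subseq (accepted_from_subseq _ _ _)) ain.
Qed.

End WheelInput.

End Graph.

Theorem theorem14 (R : realType) :
  (exists A : rule R,
     online_algorithm A /\
     forall (W : R) (s : seq (arrival R)),
       input_with_ratio W s -> cost A s <= W * OPT s)
  /\
  (forall W c : R, 1 <= W -> c < W ->
     ~ exists (A : rule R) (alpha : R),
         online_algorithm A /\
         forall s : seq (arrival R),
           input_with_ratio W s -> cost A s <= c * OPT s + alpha).
Proof.
split.
  exists (@greedy R); split; last exact: greedy_cost.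
  by move=> s _ i _; exact: greedy_spanning.
move=> W c W1 cW [A [alpha [onA comp]]].
(* [c] may be negative; [d] is nonnegative, so upper bounds on [OPT] can be multiplied by it, and it
   is still below [W]. *)
pose d := Num.max c 0.
have dW : 0 < W - d by rewrite subr_gt0 gt_max cW (lt_le_trans ltr01 W1).
have bound n : n.+1%:R * (W - d) <= d * W + alpha - W.
  have ratio := wheel_ratio n W1; have [Is _ _] := ratio.
  have h1 := comp _ ratio; have h2 := cost_wheel_ge n.+1 W1 onA.
  have h3 : c * OPT (wheel W n.+1) <= d * (W + n.+1%:R).
    apply: (@le_trans _ _ (d * OPT (wheel W n.+1))).
      by rewrite ler_wpM2r ?OPT_ge0 // le_max lexx.
    by rewrite ler_wpM2l ?OPT_wheel_le // le_max lexx orbT.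
  have h4 : W * n.+2%:R = W + n.+1%:R * W.
    by rewrite -natr1 mulrDr mulr1 addrC mulrC.
  lra.
(* The right side of [bound] does not depend on [n]; this [n] makes [n.+1] exceed its quotient by
   [W - d]. *)
have := bound (Num.truncn ((d * W + alpha - W) / (W - d))).
by rewrite -ler_pdivlMr // leNgt truncnS_gt.
Qed.
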